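(* Let $F=(\phi,\psi):\mathbb{D}^2\to\mathbb{D}^2$ be holomorphic without fixed points in $\mathbb{D}^2$, with $\phi$ a left Type II function and $\psi$ a right Type II function, and let $\tau=(\tau^1,\tau^2)\in\mathbb{T}^2$ and $K>0$ be such that $\tau$ is simultaneously a left Type II DW point for $\phi$ with constant $K$ and a right Type II DW point for $\psi$ with constant $1/K$. Fix $(\lambda_0,\mu_0)\in\mathbb{D}^2$, write $F^n(\lambda_0,\mu_0)=(\phi_n,\psi_n)$ and set $$A_n=\frac{|\tau^1-\phi_n|^2}{1-|\phi_n|^2},\qquad B_n=\frac{|\tau^2-\psi_n|^2}{1-|\psi_n|^2}.$$ Then either $F^n(\lambda_0,\mu_0)\to\tau$ in the horospheric topology, or there exist $\rho_0,\rho_1\ge0$ (depending on $(\lambda_0,\mu_0)$), not both $0$, such that $$A_{2n}\to\rho_0,\quad A_{2n+1}\to\rho_1,\quad B_{2n+1}\to K\rho_0,\quad B_{2n}\to K\rho_1.$$ Moreover, if $\tau$ fails to be a C-point for at least one of $\phi$ and $\psi$, one can take $\rho_0=\rho_1$.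
   Context: Notation. $\mathbb{D}$ is the open unit disk, $\mathbb{T}=\partial\mathbb{D}$, $\mathrm{cl}$ denotes closure. Superscripts $1,2$ on points are coordinate indices: $\lambda=(\lambda^1,\lambda^2)$. $\|(\lambda^1,\lambda^2)\|=\max\{|\lambda^1|,|\lambda^2|\}$. $\pi^i(\lambda)=\lambda^i$ on $\mathbb{D}^2$. $F^n=F\circ\cdots\circ F$ ($n$ times). For $\phi:\mathbb{D}^2\to\mathbb{D}$, $\phi_\mu(\lambda)=\phi(\lambda,\mu)$ (slice) and $\widetilde\phi(\lambda^1,\lambda^2)=\phi(\lambda^2,\lambda^1)$. Horospheric topology. For $t\in\mathbb{T}$, $R>0$, $E(t,R)=\{z\in\mathbb{D}:\frac{|z-t|^2}{1-|z|^2}<R\}$; for $t\in\mathbb{D}$, $E(t,R)=\mathbb{D}$. For $\tau\in\partial\mathbb{D}^2$, $E(\tau,R_1,R_2)=E(\tau^1,R_1)\times E(\tau^2,R_2)$. The horospheric topology on $\mathrm{cl}(\mathbb{D}^2)$ has as base all open subsets of $\mathbb{D}^2$ together with all sets $\{\tau\}\cup E(\tau,R_1,R_2)$, $\tau\in\partial\mathbb{D}^2$, $R_1,R_2>0$. Models. A model $(\mathcal{M},u)$ for a holomorphic $\phi:\mathbb{D}^2\to\mathbb{D}$ consists of a separable Hilbert space with orthogonal decomposition $\mathcal{M}=\mathcal{M}^1\oplus\mathcal{M}^2$ and a holomorphic map $u:\mathbb{D}^2\to\mathcal{M}$, $\lambda\mapsto u_\lambda$, such that for all $\lambda,\mu\in\mathbb{D}^2$,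 $1-\phi(\lambda)\overline{\phi(\mu)}=(1-\lambda^1\overline{\mu^1})\langle u^1_\lambda,u^1_\mu\rangle+(1-\lambda^2\overline{\mu^2})\langle u^2_\lambda,u^2_\mu\rangle$, where $v^j$ is the orthogonal projection of $v\in\mathcal{M}$ onto $\mathcal{M}^j$. Every such $\phi$ has a model. Boundary points. A set $S\subset\mathbb{D}^2$ approaches $\tau\in\partial\mathbb{D}^2$ nontangentially if $\tau\in\mathrm{cl}(S)$ and there is $c>0$ with $\|\tau-\lambda\|\le c(1-\|\lambda\|)$ for all $\lambda\in S$. $\tau\in\partial\mathbb{D}^2$ is a B-point for $\phi$ if $\liminf_{\lambda\to\tau}\frac{1-|\phi(\lambda)|}{1-\|\lambda\|}<\infty$; then the nontangential limit of $\phi$ at $\tau$ exists and is denoted $\phi(\tau)$. A B-point $\tau$ is a C-point if $\phi$ has an angular gradient at $\tau$, i.e. there is $\eta\in\mathbb{C}^2$ with $\phi(\lambda)=\phi(\tau)+\eta^1(\lambda^1-\tau^1)+\eta^2(\lambda^2-\tau^2)+o(\|\lambda-\tau\|)$ as $\lambda\to\tau$ nontangentially. For a B-point $\tau$, $Y_\tau$ is the set of weak limits in $\mathcal{M}$ of weakly convergent sequences $\{u_{\lambda_n}\}$, over sequences $\lambda_n\to\tau$ in $\mathbb{D}^2$ for which $\frac{1-|\phi(\lambda_n)|}{1-\|\lambda_n\|}$ stays bounded. Types of functions. $\phi$ is a left Type II function if $\phi\ne\pi^1$ and there is a holomorphic $\xi:\mathbb{D}\to\mathbb{D}$ such that for all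 $\lambda,\mu\in\mathbb{D}$: $\phi_\mu(\lambda)=\lambda$ if and only if $\xi(\mu)=\lambda$. $\phi$ is a right Type II function if $\widetilde\phi$ is a left Type II function. DW points. For $\phi\ne\pi^1$ with model $(\mathcal{M},u)$: a point $(\tau^1,\sigma)\in\mathbb{T}\times\mathrm{cl}(\mathbb{D})$ is a left Type I DW point for $\phi$ if it is a B-point, $\phi(\tau^1,\sigma)=\tau^1$, and there exists $v\in Y_{(\tau^1,\sigma)}$ with $\|v^1\|\le1$ and $v^2=0$. A point $\tau=(\tau^1,\tau^2)\in\mathbb{T}^2$ is a left Type II DW point for $\phi$ if it is a B-point, $\phi(\tau)=\tau^1$, there exists $u_\tau\in Y_\tau$ with $\|u^1_\tau\|<1$, and $\tau$ is not a left Type I DW point for $\phi$; if moreover $K>0$ is such that $\|u^1_\tau\|^2+K\|u^2_\tau\|^2\le1$ for such a $u_\tau$, then $\tau$ is a left Type II DW point with constant $K$. If $\phi\ne\pi^2$, $(\tau^1,\tau^2)\in\mathbb{T}^2$ is a right Type II DW point for $\phi$ (with constant $K$) if $(\tau^2,\tau^1)$ is a left Type II DW point for $\widetilde\phi$ (with constant $K$). (Under the hypotheses on $F$ of the theorem, such $\tau$ and $K$ always exist.) *)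

(* Defs.v *)
From HB Require Import structures.
From mathcomp Require Import all_boot all_order all_algebra.
From mathcomp Require Import sesquilinear complex.
From mathcomp Require Import all_classical all_reals all_analysis.

Set Implicit Arguments.
Unset Strict Implicit.
Unset Printing Implicit Defensive.
Import Order.TTheory GRing.Theory Num.Theory numFieldNormedType.Exports.

Local Open Scope classical_set_scope.
Local Open Scope complex_scope.
Local Open Scope ring_scope.

(* Library norms over the field R[i] take values in R[i]; [cmod] and [bnorm]
   are the real-valued modulus on C and max-norm on C^2. Functions on D or D^2
   are total functions of which only the values on D or D^2 are used. *)
Notation Cplx R := (R[i]^o).
Notation Cplx2 R := (R[i]^o * R[i]^o)%type.

Section Bidisk.
Variable R : realType.
Implicit Types (z t : Cplx R) (l tau : Cplx2 R) (phi : Cplx2 R -> Cplx R).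

Definition cmod z : R := ComplexField.Normc.normc z.
Definition bnorm l : R := Num.max (cmod l.1) (cmod l.2).

Definition disk : set (Cplx R) := [set z | cmod z < 1].
Definition circle : set (Cplx R) := [set z | cmod z = 1].
Definition bidisk : set (Cplx2 R) := disk `*` disk.
Definition bidisk_boundary : set (Cplx2 R) := [set l | bnorm l = 1].

Definition holomorphic_on (V W : normedModType R[i]) (D : set V) (f : V -> W) :=
  forall x, D x -> differentiable f x.

Definition holomorphic_bidisk_disk phi :=
  holomorphic_on bidisk phi /\ (forall l, bidisk l -> disk (phi l)).

Definition tilde phi : Cplx2 R -> Cplx R := fun l => phi (l.2, l.1).

(* phi <> pi^1 as functions on the bidisk *)
Definition neq_pi1 phi := ~ (forall l, bidisk l -> phi l = l.1).

Definition left_typeII phi :=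
  neq_pi1 phi /\
  exists xi : Cplx R -> Cplx R,
    [/\ holomorphic_on disk xi,
        forall z, disk z -> disk (xi z) &
        forall la mu, disk la -> disk mu -> (phi (la, mu) = la <-> xi mu = la)].

Definition right_typeII phi := left_typeII (tilde phi).

Definition horo t z : R := cmod (t - z) ^+ 2 / (1 - cmod z ^+ 2).

Definition horodisk t (r : R) : set (Cplx R) :=
  [set z | disk z /\ (circle t -> horo t z < r)].

Definition horo_base : set (set (Cplx2 R)) :=
  [set B | (open B /\ B `<=` bidisk) \/
     exists tau r1 r2, [/\ bidisk_boundary tau, 0 < r1, 0 < r2 &
       B = [set tau] `|` (horodisk tau.1 r1 `*` horodisk tau.2 r2)]].

Definition horo_open : set (set (Cplx2 R)) :=
  [set \bigcup_(B in G) B | G in subset^~ horo_base].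

Definition horo_cvg (x : nat -> Cplx2 R) (tau : Cplx2 R) :=
  forall U, horo_open U -> U tau -> \forall n \near \oo, U (x n).

Definition julia_quotient phi l : R := (1 - cmod (phi l)) / (1 - bnorm l).

Definition B_point phi tau :=
  bidisk_boundary tau /\
  (limf_einf (fun l => (julia_quotient phi l)%:E) (within bidisk (nbhs tau))
     < +oo)%E.

Definition nontangential tau (S : set (Cplx2 R)) :=
  [/\ S `<=` bidisk, closure S tau &
      exists2 c : R, 0 < c &
        forall l, S l -> bnorm (tau - l) <= c * (1 - bnorm l)].

Definition nontangential_lim phi tau (w : Cplx R) :=
  forall S, nontangential tau S -> phi l @[l --> within S (nbhs tau)] --> w.

(* w is the boundary value phi(tau). *)
Definition C_point phi tau :=
  B_point phi tau /\
  exists w (eta : Cplx2 R), nontangential_lim phi tau w /\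
    forall S, nontangential tau S ->
      let F := within S (nbhs tau) in
      (fun l => phi l - (w + eta.1 * (l.1 - tau.1) + eta.2 * (l.2 - tau.2)))
        =o_F (fun l => l - tau).

End Bidisk.

(* The inner product is linear in its first argument. *)
Record separable_hilbert (R : realType) := SeparableHilbert {
  hilbert_sort :> completeNormedModType R[i];
  hdot : {dot hilbert_sort for Num.conj};
  hdot_norm : forall x, hdot x x = `|x| ^+ 2;
  hilbert_separable : exists D : set hilbert_sort, countable D /\ dense D }.

Definition weak_cvg (R : realType) (H : separable_hilbert R)
    (x : nat -> H) (y : H) :=
  forall h : H, (hdot H (x n) h : Cplx R) @[n --> \oo] --> (hdot H y h : Cplx R).

(* [orth1] and [orth2] are determined by the axioms: they are the orthogonal
   projections onto the two summands. *)
Record model (R : realType) (phi : Cplx2 R -> Cplx R) := Model {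
  mspace :> separable_hilbert R;
  M1 : {pred mspace};
  M2 : {pred mspace};
  M1_submod : submod_closed M1;
  M2_submod : submod_closed M2;
  M1_closed : closed [set x | x \in M1];
  M2_closed : closed [set x | x \in M2];
  M12_ortho : forall x y, x \in M1 -> y \in M2 -> hdot mspace x y = 0;
  orth1 : mspace -> mspace;
  orth2 : mspace -> mspace;
  orth1_in : forall v, orth1 v \in M1;
  orth2_in : forall v, orth2 v \in M2;
  orth_sum : forall v, v = orth1 v + orth2 v;
  model_map : Cplx2 R -> mspace;
  model_map_holo : holomorphic_on (@bidisk R) model_map;
  model_eq : forall la mu : Cplx2 R, bidisk la -> bidisk mu ->
    1 - phi la * Num.conj (phi mu) =
      (1 - la.1 * Num.conj mu.1)
        * hdot mspace (orth1 (model_map la)) (orth1 (model_map mu))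
    + (1 - la.2 * Num.conj mu.2)
        * hdot mspace (orth2 (model_map la)) (orth2 (model_map mu)) }.

Section DWPoints.
Variables (R : realType) (phi : Cplx2 R -> Cplx R) (M : model phi).
Implicit Types (tau : Cplx2 R) (K : R).

Definition Y_set tau : set M :=
  [set y | exists l : nat -> Cplx2 R,
    [/\ forall n, bidisk (l n),
        l n @[n --> \oo] --> tau,
        exists b : R, forall n, julia_quotient phi (l n) <= b &
        weak_cvg (fun n => model_map M (l n)) y]].

Definition left_typeI_DW tau :=
  [/\ circle tau.1 /\ cmod tau.2 <= 1,
      B_point phi tau,
      nontangential_lim phi tau tau.1 &
      exists v : M, [/\ Y_set tau v, `|orth1 v| <= 1 & orth2 v = 0]].

Definition left_typeII_DW tau :=
  [/\ circle tau.1 /\ circle tau.2,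
      B_point phi tau,
      nontangential_lim phi tau tau.1,
      exists u : M, Y_set tau u /\ `|orth1 u| < 1 &
      ~ left_typeI_DW tau].

Definition left_typeII_DW_const tau K :=
  [/\ left_typeII_DW tau, 0 < K &
      exists u : M, [/\ Y_set tau u, `|orth1 u| < 1 &
        `|orth1 u| ^+ 2 + K%:C * `|orth2 u| ^+ 2 <= 1]].

End DWPoints.

Definition right_typeII_DW_const (R : realType) (psi : Cplx2 R -> Cplx R)
    (N : model (tilde psi)) (tau : Cplx2 R) (K : R) :=
  left_typeII_DW_const N (tau.2, tau.1) K.

(* Main.v *)
Require Import Defs.
From mathcomp Require Import all_boot all_order all_algebra.
From mathcomp Require Import sesquilinear complex ring lra zify.
From mathcomp Require Import all_classical all_reals all_analysis.

Set Implicit Arguments.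
Unset Strict Implicit.
Unset Printing Implicit Defensive.
Import Order.TTheory GRing.Theory Num.Theory numFieldNormedType.Exports.

Local Open Scope classical_set_scope.
Local Open Scope ring_scope.

(** Everything rests on a Julia inequality at [tau] ([dw_julia]): there are a, b
    with 0 <= a < 1, 0 <= b and a + K b <= 1 such that

      horo tau^1 (phi l) <= a horo tau^1 l^1 + b horo tau^2 l^2

    on the bidisk, and symmetrically a', b' with a' + b'/K <= 1 for psi. In terms
    of A_n and B_n / K the iteration is therefore dominated by weighted averages,

      A_{n+1} <= a A_n + (1 - a) B_n/K,   B_{n+1}/K <= a' B_n/K + (1 - a') A_n.

    If a or a' is positive, both sequences converge to the limit of their
    maximum; if a = a' = 0, each of A_0, B_1/K, A_2, ... and B_0/K, A_1, B_2/K, ...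
    decreases ([coupled_averages]). This produces rho_0 and rho_1, and when both
    vanish the orbit enters every horosphere at [tau].

    For the Julia inequality, a vector u of Y_tau satisfies the model equation
    with its second point moved to [tau], namely

      1 - phi(l) conj tau^1 = sum_i (1 - l^i conj tau^i) <u_l^i, u^i>

    ([weak_limit_boundary_value]), and the Cauchy-Schwarz inequality then gives
    a = |u^1|^2, b = |u^2|^2 ([julia_inequality]).

    The last assertion needs a > 0 whenever [tau] is not a C-point of phi, and
    likewise a' > 0 for psi. The only obstacle is u^1 = 0. In this case the
    equation above shows that phi has an angular gradient provided <u_l^2, u^2>
    tends to |u^2|^2 nontangentially ([C_point_of_cvg]). Otherwise some points m
    near [tau] keep <u_m^2, u^2> away from |u^2|^2. The equation is affine in u,
    and u_m is nearly another solution, so the combinations u + t (u_m - u) are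
    near-solutions too; for a small t with the right phase they have a strictly
    smaller |v^1|^2 + K |v^2|^2 ([improved_boundary_value]). The Julia inequality
    only needs such near-solutions with controlled norms, and so it holds with
    some a > 0 and a + K b < 1. *)

Local Open Scope complex_scope.

(** * Moduli, max-norms and limits *)

Section Modulus.
Variable R : realType.
Implicit Types (z w t : Cplx R) (l tau : Cplx2 R) (r d e : R).

Lemma normr_cmod z : `|z| = (cmod z)%:C. Proof. by []. Qed.

Lemma cmod_ge0 z : 0 <= cmod z.
Proof. by rewrite -ler0c -normr_cmod. Qed.

Lemma cmodD z w : cmod (z + w) <= cmod z + cmod w.
Proof. by rewrite -lecR rmorphD -!normr_cmod ler_normD. Qed.

Lemma cmodM z w : cmod (z * w : R[i]) = cmod z * cmod w.
Proof. exact: ComplexField.Normc.normcM. Qed.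

Lemma cmodN z : cmod (- z) = cmod z.
Proof. by apply: complexI; rewrite -!normr_cmod normrN. Qed.

Lemma cmodBC z w : cmod (z - w) = cmod (w - z).
Proof. by rewrite -cmodN opprB. Qed.

Lemma cmodJ z : cmod (Num.conj (z : R[i])) = cmod z.
Proof. by apply: complexI; rewrite -!normr_cmod; exact: norm_conjC. Qed.

Lemma cmodr r : 0 <= r -> cmod (r%:C) = r.
Proof.
by move=> r0; apply: complexI; rewrite -normr_cmod; apply: ger0_norm; rewrite ler0c.
Qed.

Lemma cmod0 : cmod (0 : Cplx R) = 0. Proof. exact: (@cmodr 0). Qed.

Lemma cmod1 : cmod (1 : Cplx R) = 1. Proof. exact: (@cmodr 1). Qed.

Lemma cmod_eq0 z : cmod z = 0 -> z = 0.
Proof. exact: ComplexField.Normc.eq0_normc. Qed.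

Lemma cmod_sqr z : (z * Num.conj (z : R[i])) = (cmod z ^+ 2)%:C.
Proof. by rewrite rmorphXn /= -normr_cmod; apply/esym; exact: normCK. Qed.

Lemma cmod_1BJ t z : cmod t = 1 -> cmod (1 - z * Num.conj (t : R[i])) = cmod (t - z).
Proof.
move=> t1; have tt : t * Num.conj (t : R[i]) = 1 by rewrite cmod_sqr t1 expr1n.
by rewrite -[X in X - _]tt -mulrBl cmodM cmodJ t1 mulr1.
Qed.

Lemma cmod_le_1BJ z w : cmod w <= 1 -> 1 - cmod z <= cmod (1 - z * Num.conj (w : R[i])).
Proof.
move=> w1; rewrite lerBlDr.
have := cmodD (1 - z * Num.conj (w : R[i])) (z * Num.conj (w : R[i])).
rewrite subrK cmod1 cmodM cmodJ => /le_trans; apply.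
by rewrite lerD2l ler_piMr ?cmod_ge0.
Qed.

Lemma cmod1_bnorm l : cmod l.1 <= bnorm l.
Proof. by rewrite /bnorm le_max lexx. Qed.

Lemma cmod2_bnorm l : cmod l.2 <= bnorm l.
Proof. by rewrite /bnorm le_max lexx orbT. Qed.

Lemma bidisk_bnorm l : bidisk l <-> bnorm l < 1.
Proof. by rewrite /bidisk /bnorm gt_max; split=> [[? ?]|/andP[? ?]]; [apply/andP|]. Qed.

Lemma normr_bnorm l : `|l| = (bnorm l)%:C.
Proof.
rewrite prod_normE !normr_cmod /bnorm /Num.max /Order.max.
by rewrite ltcR; case: ifP.
Qed.

Lemma ball_cmod z w e : ball z e%:C w <-> cmod (w - z) < e.
Proof. by rewrite -ball_normE /ball_ /= normr_cmod ltcR cmodBC. Qed.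

Lemma nbhs_bnorm tau (P : set (Cplx2 R)) :
  nbhs tau P <-> exists2 d : R, 0 < d & forall l, bnorm (l - tau) < d -> P l.
Proof.
have bE (e : R) l : ball tau e%:C l <-> bnorm (l - tau) < e.
  rewrite /bnorm gt_max; split=> [[/ball_cmod h1 /ball_cmod h2]|/andP[h1 h2]].
    exact/andP.
  by split; apply/ball_cmod.
split=> [/nbhs_ballP[e /= e0 eP]|[d d0 dP]].
  have er : e = (complex.Re e)%:C by rewrite RRe_real // gtr0_real.
  rewrite er in e0 eP; exists (complex.Re e); first by rewrite -ltcR.
  by move=> l lt; apply: eP; apply/bE.
apply/nbhs_ballP; exists d%:C; first by rewrite /= ltcR.
by move=> l /bE; exact: dP.
Qed.

Lemma cvg_cmod (T : Type) (F : set_system T) (FF : Filter F) (f : T -> Cplx R) z :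
  f x @[x --> F] --> z <-> forall e : R, 0 < e -> \forall x \near F, cmod (f x - z) < e.
Proof.
split=> [/cvgrPdist_lt fz e e0|fz].
  have e0' : 0 < e%:C :> R[i] by rewrite ltcR.
  have := fz _ e0'; apply: filterS => x.
  by rewrite normr_cmod ltcR cmodBC.
apply/cvgrPdist_lt => e e0.
have er : e = (complex.Re e)%:C by rewrite RRe_real // gtr0_real.
rewrite er in e0 *; rewrite ltcR in e0.
by apply: filterS (fz _ e0) => x; rewrite normr_cmod ltcR cmodBC.
Qed.

Lemma cvg_bnorm (T : Type) (F : set_system T) (FF : Filter F) (f : T -> Cplx2 R) tau :
  f x @[x --> F] --> tau <->
  forall e : R, 0 < e -> \forall x \near F, bnorm (f x - tau) < e.
Proof.
split=> [ft e e0|ft P /nbhs_bnorm[d d0 dP]].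
  by apply: (ft [set l | bnorm (l - tau) < e]); apply/nbhs_bnorm; exists e.
by apply: filterS (ft d d0) => x; exact: dP.
Qed.

Lemma cvg_within_cmod (S : set (Cplx2 R)) tau (f : Cplx2 R -> Cplx R) z :
  f l @[l --> within S (nbhs tau)] --> z <->
  forall e : R, 0 < e -> exists2 d : R, 0 < d &
    forall l, S l -> bnorm (l - tau) < d -> cmod (f l - z) < e.
Proof.
split=> [/cvg_cmod fz e e0|fz].
  have /nbhs_bnorm[d d0 dP] := fz e e0; exists d => // l Sl ld; exact: dP.
apply/cvg_cmod => e e0; have [d d0 dP] := fz e e0.
by apply/nbhs_bnorm; exists d => // l ld Sl; exact: dP.
Qed.

End Modulus.

(** * The Hilbert space of a model *)

Section Hilbert.
Variables (R : realType) (H : separable_hilbert R).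
Implicit Types (x y : H).
Local Notation "''[' u , v ]" := (hdot H u%R v%R) : ring_scope.

Definition hnorm x : R := complex.Re `|x|.

Lemma normr_hnorm x : `|x| = (hnorm x)%:C.
Proof. by rewrite RRe_real // ger0_real. Qed.

Lemma hnorm_ge0 x : 0 <= hnorm x.
Proof. by rewrite -ler0c -normr_hnorm. Qed.

Lemma hdot_hnorm x : '[x, x] = (hnorm x ^+ 2)%:C.
Proof. by rewrite hdot_norm normr_hnorm rmorphXn. Qed.

Lemma hnormZ (a : R[i]) x : hnorm (a *: x) = cmod a * hnorm x.
Proof. by apply: complexI; rewrite rmorphM /= -!normr_hnorm normrZ. Qed.

Lemma ler_hnormD x y : hnorm (x + y) <= hnorm x + hnorm y.
Proof. by rewrite -lecR rmorphD /= -!normr_hnorm ler_normD. Qed.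

Lemma hnorm_opp x : hnorm (- x) = hnorm x.
Proof. by apply: complexI; rewrite -!normr_hnorm normrN. Qed.

Lemma hdotC x y : '[x, y] = Num.conj '[y, x].
Proof. by rewrite hermC /= expr0 mul1r. Qed.

Lemma hdotDl x y w : '[x + y, w] = '[x, w] + '[y, w].
Proof. exact: linearDl. Qed.

Lemma hdotDr x y w : '[w, x + y] = '[w, x] + '[w, y].
Proof. exact: linearDr. Qed.

Lemma hdotBl x y w : '[x - y, w] = '[x, w] - '[y, w].
Proof. exact: linearBl. Qed.

Lemma hdotBr x y w : '[w, x - y] = '[w, x] - '[w, y].
Proof. exact: linearBr. Qed.

Lemma hdotZl (a : R[i]) x y : '[a *: x, y] = a * '[x, y].
Proof. exact: linearZl_LR. Qed.

Lemma hdotZr (a : R[i]) x y : '[x, a *: y] = Num.conj a * '[x, y].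
Proof. exact: linearZr_LR. Qed.

Lemma hnormD_sqr x y :
  hnorm (x + y) ^+ 2 = hnorm x ^+ 2 + hnorm y ^+ 2 + complex.Re '[y, x] *+ 2.
Proof.
apply: complexI; rewrite -hdot_hnorm hdotDl !hdotDr !hdot_hnorm.
rewrite [X in _ + X + _]hdotC !rmorphD /=.
case: '[y, x] => a b; rewrite /= /Num.conj /=.
apply/eqP; rewrite eq_complex /=; apply/andP; split; apply/eqP; ring.
Qed.

Lemma CauchySchwarz_hnorm x y : cmod '[x, y] <= hnorm x * hnorm y.
Proof.
have [->|y0] := eqVneq y 0.
  rewrite linear0r; move: (hnorm_ge0 x) (hnorm_ge0 0) => *.
  by rewrite cmod0 mulr_ge0.
have hy : 0 < hnorm y by rewrite -ltcR -normr_hnorm normr_gt0.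
set z := '[x, y].
have h := hnormD_sqr ((hnorm y ^+ 2)%:C *: x) (- (z : R[i]) *: y).
have : 0 <= hnorm ((hnorm y ^+ 2)%:C *: x + (- z) *: y) ^+ 2 by exact: sqr_ge0.
rewrite h !hnormZ hdotZl hdotZr hdotC -/z.
rewrite [X in complex.Re X](_ : _ = (- (hnorm y ^+ 2 * cmod z ^+ 2))%:C); last first.
  have -> : Num.conj ((hnorm y ^+ 2)%:C : R[i]) = (hnorm y ^+ 2)%:C by exact: conjc_real.
  transitivity (- ((hnorm y ^+ 2)%:C * (z * Num.conj (z : R[i]))) : R[i]); first by ring.
  by rewrite cmod_sqr -rmorphM -rmorphN.
rewrite cmodN (@cmodr _ (hnorm y ^+2)) ?sqr_ge0 //= => h2.
rewrite -(@ler_pXn2r _ 2%N) ?nnegrE ?cmod_ge0 ?mulr_ge0 ?hnorm_ge0 //.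
have hy2 : 0 < hnorm y ^+ 2 by rewrite exprn_gt0.
rewrite -(ler_pM2l hy2); nra.
Qed.

End Hilbert.

(** * The Julia inequality from approximate boundary values *)

(** Cauchy-Schwarz for two terms with weights [q1], [q2]: the difference of the
    two sides is a single square. *)
Lemma sqr_sum2_le (R : realType) (q1 q2 p1 p2 X1 X2 a b : R) :
  0 < q1 -> 0 < q2 -> 0 <= p1 -> 0 <= p2 -> 0 <= X1 -> 0 <= X2 -> 0 <= a -> 0 <= b ->
  (p1 * X1 * Num.sqrt a + p2 * X2 * Num.sqrt b) ^+ 2 <=
  (q1 * X1 ^+ 2 + q2 * X2 ^+ 2) * (a * (p1 ^+ 2 / q1) + b * (p2 ^+ 2 / q2)).
Proof.
move=> q1p q2p p1p p2p X1p X2p ap bp.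
have q10 : q1 != 0 by lra.
have q20 : q2 != 0 by lra.
rewrite -[in X in _ <= _ * X](sqr_sqrtr ap) -[in X in _ <= _ * X](sqr_sqrtr bp).
move: (Num.sqrt a) (Num.sqrt b) => x y.
rewrite -subr_ge0.
rewrite [X in 0 <= X](_ : _ = (q1 * X1 * p2 * y - q2 * X2 * p1 * x) ^+ 2 / (q1 * q2)).
  by rewrite divr_ge0 ?sqr_ge0 // mulr_ge0 ?ltW.
by field; rewrite q10 q20.
Qed.

Definition model_map1 (R : realType) (phi : Cplx2 R -> Cplx R) (M : model phi) l : M :=
  orth1 (model_map M l).
Definition model_map2 (R : realType) (phi : Cplx2 R -> Cplx R) (M : model phi) l : M :=
  orth2 (model_map M l).

Section ModelTheory.
Variables (R : realType) (phi : Cplx2 R -> Cplx R) (M : model phi).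
Implicit Types (l m tau : Cplx2 R) (S : set (Cplx2 R)) (a b e : R).
Hypothesis phiD : forall l, bidisk l -> disk (phi l).

Local Notation "''[' u , v ]" := (hdot M u%R v%R) : ring_scope.
Local Notation cj z := (Num.conj (z : R[i])).
Local Notation U1 := (model_map1 M).
Local Notation U2 := (model_map2 M).

Lemma model_norm l : bidisk l ->
  1 - cmod (phi l) ^+ 2 =
  (1 - cmod l.1 ^+ 2) * hnorm (U1 l) ^+ 2 + (1 - cmod l.2 ^+ 2) * hnorm (U2 l) ^+ 2.
Proof.
move=> lD; apply: complexI.
have c (z : Cplx R) : (1 - cmod z ^+ 2)%:C = 1 - z * cj z.
  by rewrite cmod_sqr [LHS]rmorphB.
have d (x : M) z : ((1 - cmod z ^+ 2) * hnorm x ^+ 2)%:C = (1 - z * cj z) * '[x, x].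
  by rewrite hdot_hnorm -c -[RHS]rmorphM.
by rewrite c (model_eq M lD lD) -!d -rmorphD.
Qed.

Lemma disk_sqr (z : Cplx R) : disk z -> 0 < 1 - cmod z ^+ 2.
Proof. by rewrite /disk /= => h; have := cmod_ge0 z; nra. Qed.

(** The failure of the model equation at [l] when the second point is replaced
    by [tau], the value of phi there by [tau.1] and the value of the model map
    there by the pair [(v1, v2)]. It vanishes for every [l] when [(v1, v2)] are
    the components of a boundary value of the model map at [tau], and it is
    affine (conjugate-linearly) in the pair. *)
Definition defect tau l (v1 v2 : M) : R[i] :=
  1 - phi l * cj tau.1
  - ((1 - l.1 * cj tau.1) * '[U1 l, v1] + (1 - l.2 * cj tau.2) * '[U2 l, v2]).

(** The vectors may depend on [l] and [e]; only the bounds on their norms are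
    uniform. Therefore the vectors u_m at points m near [tau] can serve directly,
    without a weak limit being extracted from them. *)
Definition approx_boundary_value tau a b := forall l e, bidisk l -> 0 < e ->
  exists v1 v2 : M, [/\ hnorm v1 ^+ 2 <= a, hnorm v2 ^+ 2 <= b &
    cmod (defect tau l v1 v2) <= e].

(** The model equation gives |1 - phi(l) conj tau^1| as a sum of two products,
    each bounded by |tau^i - l^i| |u_l^i| |v^i|. The weighted Cauchy-Schwarz
    inequality with weights 1 - |l^i|^2 turns the |u_l^i| into 1 - |phi(l)|^2,
    by the model equation on the diagonal, and leaves the quotients [horo]. *)
Lemma julia_inequality tau a b : circle tau.1 -> circle tau.2 ->
  approx_boundary_value tau a b -> forall l, bidisk l ->
  horo tau.1 (phi l) <= a * horo tau.1 l.1 + b * horo tau.2 l.2.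
Proof.
move=> t1 t2 ab l lD.
have [v1 [v2 [va vb _]]] := ab l 1 lD ltr01.
have a0 : 0 <= a by apply: le_trans va; exact: sqr_ge0.
have b0 : 0 <= b by apply: le_trans vb; exact: sqr_ge0.
have q1 := disk_sqr lD.1; have q2 := disk_sqr lD.2.
have q := disk_sqr (phiD lD).
rewrite /horo ler_pdivrMr // mulrC model_norm //.
apply: le_trans (sqr_sum2_le q1 q2 (cmod_ge0 _) (cmod_ge0 _) (hnorm_ge0 _)
  (hnorm_ge0 _) a0 b0).
rewrite ler_pXn2r ?nnegrE ?cmod_ge0 ?addr_ge0 ?mulr_ge0 ?cmod_ge0 ?hnorm_ge0 ?sqrtr_ge0 //.
apply/ler_addgt0Pr => e e0.
have {va vb v1 v2}[v1 [v2 [va vb]]] := ab l e lD e0; rewrite /defect => ve.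
rewrite -(cmod_1BJ _ t1) -[X in cmod X](subrK
  ((1 - l.1 * cj tau.1) * '[U1 l, v1] + (1 - l.2 * cj tau.2) * '[U2 l, v2])).
apply: le_trans (cmodD _ _) _; rewrite addrC lerD //.
apply: le_trans (cmodD _ _) _.
rewrite !cmodM !cmod_1BJ // -!mulrA lerD // ler_wpM2l ?cmod_ge0 //.
  apply: le_trans (CauchySchwarz_hnorm _ _) _; rewrite ler_wpM2l ?hnorm_ge0 //.
  by rewrite -(ler_pXn2r (ltn0Sn 1)) ?nnegrE ?hnorm_ge0 ?sqrtr_ge0 // sqr_sqrtr.
apply: le_trans (CauchySchwarz_hnorm _ _) _; rewrite ler_wpM2l ?hnorm_ge0 //.
by rewrite -(ler_pXn2r (ltn0Sn 1)) ?nnegrE ?hnorm_ge0 ?sqrtr_ge0 // sqr_sqrtr.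
Qed.

Lemma bidisk_le1 l : bidisk l -> cmod l.1 <= 1 /\ cmod l.2 <= 1.
Proof. by move=> [/ltW ? /ltW ?]. Qed.

(** An interior point [m] close to [tau], with phi(m) close to [tau.1], supplies
    an approximate boundary value: subtracting the exact model equation at
    [(l, m)] leaves only terms in phi(m) - tau^1 and m - tau. *)
Lemma defect_interior tau l m : bidisk l -> bidisk m ->
  cmod (defect tau l (U1 m) (U2 m)) <= cmod (phi m - tau.1)
    + bnorm (m - tau) * (hnorm (U1 l) * hnorm (U1 m) + hnorm (U2 l) * hnorm (U2 m)).
Proof.
move=> lD mD; have := model_eq M lD mD; rewrite -/(U1 l) -/(U1 m) -/(U2 l) -/(U2 m) => E.
have -> : defect tau l (U1 m) (U2 m) = phi l * cj (phi m - tau.1)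
   + (- (l.1 * cj (m.1 - tau.1) * '[U1 l, U1 m])
    - l.2 * cj (m.2 - tau.2) * '[U2 l, U2 m]).
  rewrite /defect !rmorphB.
  move: E; set x := '[U1 l, U1 m]; set y := '[U2 l, U2 m].
  set z := phi l * cj (phi m) => E.
  have -> : 1 - phi l * cj tau.1 = z - phi l * cj tau.1
     + ((1 - l.1 * cj m.1) * x + (1 - l.2 * cj m.2) * y).
    by rewrite -E; ring.
  by rewrite /z; ring.
have [l1 l2] := bidisk_le1 lD; have /ltW pl := phiD lD.
apply: le_trans (cmodD _ _) _; apply: lerD.
  by rewrite cmodM cmodJ ler_piMl ?cmod_ge0.
apply: le_trans (cmodD _ _) _; rewrite !cmodN !cmodM !cmodJ mulrDr.
have h (x1 x2 x3 y1 y2 : R) : 0 <= x1 -> x1 <= 1 -> 0 <= x2 -> x2 <= y1 -> 0 <= x3 ->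
    x3 <= y2 -> x1 * x2 * x3 <= y1 * y2.
  move=> *; apply: ler_pM => //; first exact: mulr_ge0.
  by apply: le_trans (ler_piMl _ _) _.
apply: lerD; apply: h; rewrite ?cmod_ge0 //; try exact: CauchySchwarz_hnorm.
- exact: (cmod1_bnorm (m - tau)).
- exact: (cmod2_bnorm (m - tau)).
Qed.

(** The weights 1 - |l^i|^2 in the diagonal model equation are at least
    1 - ||l||, so the Julia quotient controls the norm of the model map. *)
Lemma hnorm_model_julia l : bidisk l ->
  hnorm (U1 l) ^+ 2 + hnorm (U2 l) ^+ 2 <= 2 * julia_quotient phi l.
Proof.
move=> lD; have := model_norm lD; have [l1 l2] := lD.
have /bidisk_bnorm lb := lD; have := phiD lD; rewrite /disk /= => p1.
rewrite /julia_quotient [2 * _]mulrA ler_pdivlMr ?subr_gt0 //.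
have := cmod1_bnorm l; have := cmod2_bnorm l; move: l1 l2 lb p1; rewrite /disk /=.
move: (cmod_ge0 l.1) (cmod_ge0 l.2) (cmod_ge0 (phi l)) (sqr_ge0 (hnorm (U1 l))) (sqr_ge0 (hnorm (U2 l))).
move: (cmod l.1) (cmod l.2) (cmod (phi l)) (bnorm l) (_ ^+ 2) (_ ^+ 2) => c1 c2 p n x y.
move=> c10 c20 p0 x0 y0 c11 c21 n1 p1 c2n c1n E.
have hp : 1 - p ^+ 2 <= 2 * (1 - p) by nra.
have h1 : 1 - n <= 1 - c1 ^+ 2 by nra.
have h2 : 1 - n <= 1 - c2 ^+ 2 by nra.
nra.
Qed.

End ModelTheory.

(** * Boundary values of the model map at a B-point *)

Section BoundaryValues.
Variables (R : realType) (phi : Cplx2 R -> Cplx R) (M : model phi).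
Variable tau : Cplx2 R.
Implicit Types (l m : Cplx2 R) (S : set (Cplx2 R)) (a b e C : R) (x : nat -> Cplx2 R).
Hypothesis phiD : forall l, bidisk l -> disk (phi l).
Hypotheses (t1 : circle tau.1) (t2 : circle tau.2).

Local Notation "''[' u , v ]" := (hdot M u%R v%R) : ring_scope.
Local Notation cj z := (Num.conj (z : R[i])).
Local Notation U1 := (model_map1 M).
Local Notation U2 := (model_map2 M).

Lemma model_bounded x b : (forall n, bidisk (x n)) ->
  (forall n, julia_quotient phi (x n) <= b) ->
  exists2 C, 0 <= C & forall n, hnorm (U1 (x n)) <= C /\ hnorm (U2 (x n)) <= C.
Proof.
move=> xD xb; have key n := hnorm_model_julia M phiD (xD n).
have b0 : 0 <= b.
  have := key 0%N; have := xb 0%N.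
  have := sqr_ge0 (hnorm (U1 (x 0%N))).
  have := sqr_ge0 (hnorm (U2 (x 0%N))); lra.
exists (2 * b + 1) => [|n]; first lra.
have := key n; have := xb n; rewrite -/(U1 _) -/(U2 _).
have := hnorm_ge0 (U1 (x n)); have := hnorm_ge0 (U2 (x n)).
by move=> *; split; nra.
Qed.

(** The factors 1 - l^i conj m^i are split at tau^i, so that in applications m
    tends to [tau] first, with l fixed, and l afterwards. *)
Lemma kernel_bound C l m : bidisk l -> bidisk m ->
  hnorm (U1 m) <= C -> hnorm (U2 m) <= C ->
  cmod (1 - phi l * cj (phi m)) <=
    C * ((cmod (tau.1 - l.1) + bnorm (m - tau)) * hnorm (U1 l)
       + (cmod (tau.2 - l.2) + bnorm (m - tau)) * hnorm (U2 l)).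
Proof.
move=> lD mD mC1 mC2; rewrite (model_eq M lD mD).
have [l1 l2] := bidisk_le1 lD.
have h (t c d : Cplx R) (v w : M) B : cmod t = 1 -> cmod c <= 1 -> cmod (d - t) <= B ->
    hnorm w <= C -> cmod ((1 - c * cj d) * '[v, w]) <= C * ((cmod (t - c) + B) * hnorm v).
  move=> tc c1 dB wC; rewrite cmodM mulrCA [C * _]mulrC.
  have -> : 1 - c * cj d = (1 - c * cj t) - c * cj (d - t) by rewrite rmorphB; ring.
  apply: ler_pM; rewrite ?cmod_ge0 //.
    apply: le_trans (cmodD _ _) _; rewrite cmod_1BJ // lerD2l cmodN cmodM cmodJ.
    by apply: le_trans dB; rewrite ler_piMl // cmod_ge0.
  by apply: le_trans (CauchySchwarz_hnorm _ _) _; rewrite ler_wpM2l ?hnorm_ge0.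
apply: le_trans (cmodD _ _) _; rewrite mulrDr; apply: lerD; apply: h => //.
- exact: (cmod1_bnorm (m - tau)).
- exact: (cmod2_bnorm (m - tau)).
Qed.

(* A sequence as in the definition of Y_tau. *)
Variables (x : nat -> Cplx2 R) (b : R).
Hypotheses (xD : forall n, bidisk (x n)) (xtau : x n @[n --> \oo] --> tau)
  (xb : forall n, julia_quotient phi (x n) <= b).

(** Since |phi| <= 1 along the sequence, 1 - |phi(l)| is at most
    |1 - phi(l) conj phi(x_n)|; let n tend to infinity in [kernel_bound]. *)
Lemma model_growth : exists2 C, 0 <= C & forall l, bidisk l ->
  1 - cmod (phi l) ^+ 2 <=
    C * (cmod (tau.1 - l.1) * hnorm (U1 l) + cmod (tau.2 - l.2) * hnorm (U2 l)).
Proof.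
have [C C0 xC] := model_bounded xD xb.
exists (2 * C) => [|l lD]; first lra.
apply/ler_addgt0Pr => e e0.
pose s := hnorm (U1 l) + hnorm (U2 l).
have s0 : 0 <= s by rewrite addr_ge0 ?hnorm_ge0.
have d0 : 0 < e / (2 * C * s + 1) by rewrite divr_gt0 // ltr_pwDr // ?mulr_ge0.
have /cvg_bnorm/(_ _ d0) [N _ /(_ N (leqnn N))/= xN] := xtau.
have [c1 c2] := xC N.
have k := kernel_bound lD (xD N) c1 c2.
have := cmod_le_1BJ (phi l) (ltW (phiD (xD N))) => /le_trans/(_ k).
have h : 2 * C * s * bnorm (x N - tau) <= e.
  rewrite ltr_pdivlMr ?ltr_pwDr ?mulr_ge0 // in xN.
  have := cmod_ge0 (x N - tau).1; have := cmod1_bnorm (x N - tau).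
  by move: (bnorm _) xN => d *; nra.
have := phiD lD; rewrite /disk /=; move: h; rewrite /s.
have := cmod_ge0 (phi l); move: (cmod (phi l)) (cmod (_ - _)) (cmod (_ - _)) (bnorm _).
move=> p p1 p2 d p0 h pl k2.
apply: (@le_trans _ _ (2 * (1 - p))); first nra.
nra.
Qed.

(** On a nontangential set |tau^i - l^i| is comparable with 1 - ||l||, hence
    [model_growth] compares a quadratic expression in the norms of the model
    map with a linear one. *)
Lemma model_nontangential_bounded S : nontangential tau S ->
  exists2 C, 0 <= C & forall l, S l -> hnorm (U1 l) <= C /\ hnorm (U2 l) <= C.
Proof.
move=> [SD _ [c c0 Sc]]; have [C C0 gr] := model_growth.
exists (2 * (C * c)) => [|l Sl]; first nra.
have lD := SD l Sl; have := gr l lD; rewrite (model_norm M lD) -/(U1 l) -/(U2 l).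
have := Sc l Sl; have /bidisk_bnorm := lD.
have := cmod1_bnorm (tau - l); have := cmod2_bnorm (tau - l) => /=.
have := cmod1_bnorm l; have := cmod2_bnorm l.
have := cmod_ge0 l.1; have := cmod_ge0 l.2.
have := hnorm_ge0 (U1 l); have := hnorm_ge0 (U2 l).
move: (hnorm (U1 l)) (hnorm (U2 l)) (bnorm (tau - l)) => X1 X2 B.
move: (cmod l.1) (cmod l.2) (bnorm l) (cmod (_ - _)) (cmod (_ - _)).
move=> c1 c2 n p1 p2 X20 X10 c20 c10 c2n c1n p2B p1B n1 Bn E.
have : (1 - n) * (X1 ^+ 2 + X2 ^+ 2) <= (1 - n) * ((C * c) * (X1 + X2)).
  have h1 : 1 - n <= 1 - c1 ^+ 2 by nra.
  have h2 : 1 - n <= 1 - c2 ^+ 2 by nra.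
  apply: le_trans (le_trans E _).
    by rewrite mulrDr lerD // ler_wpM2r ?sqr_ge0.
  rewrite [leRHS](_ : _ = C * (c * (1 - n) * X1 + c * (1 - n) * X2)); last by ring.
  by rewrite ler_wpM2l // lerD // ler_wpM2r //; lra.
rewrite ler_pM2l ?subr_gt0 // => h.
have D0 : 0 <= C * c by rewrite mulr_ge0 // ltW.
move: (C * c) D0 h => D D0 h.
have : X1 + X2 <= 2 * D; last by move=> *; split; lra.
rewrite leNgt; apply/negP => lt; have := sqr_ge0 (X1 - X2).
have : 0 < (X1 + X2) * (X1 + X2 - 2 * D) by rewrite mulr_gt0 //; lra.
nra.
Qed.

Lemma radial_nontangential :
  nontangential tau [set (r%:C * tau.1, r%:C * tau.2) | r in [set r : R | 0 < r < 1]].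
Proof.
have bn (r : R) : 0 <= r -> bnorm (r%:C * tau.1 : Cplx R, r%:C * tau.2 : Cplx R) = r.
  by move=> r0; rewrite /bnorm /= !cmodM !cmodr // t1 t2 !mulr1 maxxx.
have bd (r : R) : r <= 1 ->
    bnorm (tau - (r%:C * tau.1 : Cplx R, r%:C * tau.2 : Cplx R)) = 1 - r.
  move=> r1; rewrite /bnorm /=.
  have h (t : Cplx R) : cmod t = 1 -> cmod (t - r%:C * t) = 1 - r.
    move=> tc; have -> : t - r%:C * t = (1 - r)%:C * t by rewrite rmorphB mulrBl mul1r.
    by rewrite cmodM cmodr ?subr_ge0 // tc mulr1.
  by rewrite !h ?maxxx.
split.
- by move=> _ [r /andP[r0 r1] <-]; apply/bidisk_bnorm; rewrite bn // ltW.
- move=> P /nbhs_bnorm[d d0 dP].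
  pose r := 1 - Num.min (d / 2) (1 / 2).
  have [m0 md m2] : [/\ 0 < Num.min (d / 2) (1 / 2), Num.min (d / 2) (1 / 2) < d &
      Num.min (d / 2) (1 / 2) < 1].
    by split; [rewrite lt_min|rewrite gt_min|rewrite gt_min]; lra.
  exists (r%:C * tau.1, r%:C * tau.2); split.
    by exists r => //=; rewrite /r; apply/andP; split; lra.
  apply: dP; rewrite -opprB.
  have -> l : bnorm (- l) = bnorm l by rewrite /bnorm /= !cmodN.
  by rewrite bd /r; lra.
- exists 1 => // _ [r /andP[r0 r1] <-].
  by rewrite bn ?bd ?mul1r // ltW.
Qed.

Hypothesis phitau : nontangential_lim phi tau tau.1.

(** The sequence may be tangential, so the nontangential limit of phi does not
    apply to it directly. It is compared with a point l = r tau of the radius: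
    there phi is close to [tau.1] and the model map is bounded, so that
    [kernel_bound] makes 1 - phi(l) conj phi(x_n) of the order of 1 - r. *)
Lemma phi_cvg_seq e : 0 < e -> \forall n \near \oo, cmod (phi (x n) - tau.1) < e.
Proof.
move=> e0; have [C C0 xC] := model_bounded xD xb.
have [B B0 SB] := model_nontangential_bounded radial_nontangential.
have /cvg_within_cmod h := phitau radial_nontangential.
have e20 : 0 < e / 2 by lra.
have [d d0 dP] := h _ e20.
(* With 1 - r and ||x_n - tau|| below e / (4 D), the bound 2 C B (1 - r + ||x_n - tau||)
   of the kernel is below e / 2. *)
pose D := 4 * C * B + 1.
have D1 : 0 < D by rewrite /D ltr_pwDr // !mulr_ge0.
pose s := Num.min (Num.min (d / 2) (1 / 2)) (e / (4 * D)).
have eD : 0 < e / (4 * D) by rewrite divr_gt0 //; lra.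
have [s0 sd s1 se] : [/\ 0 < s, s < d, s < 1 & s <= e / (4 * D)].
  split; rewrite /s; [|rewrite !gt_min; lra|rewrite !gt_min; lra|rewrite ge_min lexx orbT //].
  by rewrite !lt_min eD andbT; lra.
pose r := 1 - s; pose l : Cplx2 R := (r%:C * tau.1, r%:C * tau.2).
have lS : [set (r%:C * tau.1, r%:C * tau.2) | r in [set r : R | 0 < r < 1]] l.
  by exists r => //=; rewrite /r; apply/andP; split; lra.
have lt : cmod (tau.1 - l.1) = s /\ cmod (tau.2 - l.2) = s.
  have h' (t : Cplx R) : cmod t = 1 -> cmod (t - r%:C * t) = s.
    move=> tc; have -> : t - r%:C * t = s%:C * t.
      by rewrite /r rmorphB mulrBl mul1r opprB addrCA subrr addr0.
    by rewrite cmodM cmodr ?ltW // tc mulr1.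
  by rewrite !h'.
have lb : bnorm (l - tau) < d.
  by rewrite /bnorm /= gt_max -(cmodBC tau.1) -(cmodBC tau.2) lt.1 lt.2 sd.
have lp := dP l lS lb.
have lD : bidisk l by have [SD _ _] := radial_nontangential; exact: SD.
have [X1 X2] := SB l lS.
have /cvg_bnorm/(_ _ eD) := xtau; apply: filterS => n xn.
have [c1 c2] := xC n; have k := kernel_bound lD (xD n) c1 c2.
rewrite lt.1 lt.2 in k.
rewrite cmodBC -cmod_1BJ //.
rewrite -[cmod _]cmodJ rmorphB rmorph1 rmorphM /= conjCK mulrC.
have -> : 1 - tau.1 * cj (phi (x n)) =
  (1 - phi l * cj (phi (x n))) + (phi l - tau.1) * cj (phi (x n)) by ring.
apply: le_lt_trans (cmodD _ _) _; rewrite cmodM cmodJ.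
have q : cmod (phi l - tau.1) * cmod (phi (x n)) < e / 2.
  by apply: le_lt_trans lp; rewrite ler_piMr ?cmod_ge0 // ltW //; exact: phiD.
have := hnorm_ge0 (U1 l); have := hnorm_ge0 (U2 l); move=> X20 X10.
rewrite ler_pdivlMr in se; last lra.
rewrite ltr_pdivlMr in xn; last lra.
have : cmod (1 - phi l * cj (phi (x n))) <= e / 2; last lra.
apply: le_trans k _.
have bn0 : 0 <= bnorm (x n - tau).
  by apply: le_trans (cmod1_bnorm _); exact: cmod_ge0.
apply: (@le_trans _ _ (C * ((s + bnorm (x n - tau)) * B + (s + bnorm (x n - tau)) * B))).
  by rewrite ler_wpM2l // lerD // ler_wpM2l // addr_ge0 // ltW.
by move: (bnorm _) bn0 xn se; rewrite /D => *; nra.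
Qed.

(** Pass to the limit in [defect_interior] at the points x_n. The summands are
    orthogonal, so weak convergence of u_{x_n} tested on u_l^i gives
    convergence of the inner products of the i-th components. *)
Lemma weak_limit_boundary_value (u : M) :
  weak_cvg (fun n => model_map M (x n)) u ->
  forall l, bidisk l -> defect tau l (orth1 u) (orth2 u) = 0.
Proof.
move=> wu l lD; apply: cmod_eq0; apply/eqP; rewrite eq_le cmod_ge0 andbT.
have [C C0 xC] := model_bounded xD xb.
apply/ler_addgt0Pr => e e0; rewrite add0r.
pose D := 8 + C * (hnorm (U1 l) + hnorm (U2 l)).
have D0 : 0 < D by rewrite ltr_pwDl // mulr_ge0 // addr_ge0 ?hnorm_ge0.
have d0 : 0 < e / D by rewrite divr_gt0.
have w1 : \forall n \near \oo, cmod ('[U1 l, U1 (x n)] - '[U1 l, orth1 u]) < e / D.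
  have /cvg_cmod/(_ _ d0) := wu (U1 l); apply: filterS => n.
  have h (v : M) : '[U1 l, orth1 v] = cj '[v, U1 l].
    rewrite hdotC [in RHS](orth_sum v) hdotDl.
    by rewrite [X in _ + X]hdotC (M12_ortho (orth1_in _) (orth2_in _)) rmorph0 addr0.
  by rewrite !h -rmorphB cmodJ.
have w2 : \forall n \near \oo, cmod ('[U2 l, U2 (x n)] - '[U2 l, orth2 u]) < e / D.
  have /cvg_cmod/(_ _ d0) := wu (U2 l); apply: filterS => n.
  have h (v : M) : '[U2 l, orth2 v] = cj '[v, U2 l].
    rewrite hdotC [in RHS](orth_sum v) hdotDl.
    by rewrite (M12_ortho (orth1_in _) (orth2_in _)) add0r.
  by rewrite !h -rmorphB cmodJ.
have w3 := phi_cvg_seq d0.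
have /cvg_bnorm/(_ _ d0) w4 := xtau.
near \oo => n.
have -> : defect tau l (orth1 u) (orth2 u) = defect tau l (U1 (x n)) (U2 (x n))
  + ((1 - l.1 * cj tau.1) * ('[U1 l, U1 (x n)] - '[U1 l, orth1 u])
   + (1 - l.2 * cj tau.2) * ('[U2 l, U2 (x n)] - '[U2 l, orth2 u])).
  rewrite /defect -/(U1 l) -/(U2 l); ring.
apply: le_trans (cmodD _ _) _.
have := defect_interior M phiD tau lD (xD n); rewrite -/(U1 _) -/(U2 _) => df.
have [c1 c2] := xC n; have [l1 l2] := bidisk_le1 lD.
have p (t c : Cplx R) : cmod t = 1 -> cmod c <= 1 -> cmod (1 - c * cj t) <= 2.
  move=> tc cc; apply: le_trans (cmodD _ _) _; rewrite cmod1 cmodN cmodM cmodJ tc; lra.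
have q : e = e / D * D by rewrite divfK // gt_eqF.
have v1 : cmod ('[U1 l, U1 (x n)] - '[U1 l, orth1 u]) < e / D by near: n.
have v2 : cmod ('[U2 l, U2 (x n)] - '[U2 l, orth2 u]) < e / D by near: n.
have v3 : cmod (phi (x n) - tau.1) < e / D by near: n.
have v4 : bnorm (x n - tau) < e / D by near: n.
have v5 := cmodD ((1 - l.1 * cj tau.1) * ('[U1 l, U1 (x n)] - '[U1 l, orth1 u]))
  ((1 - l.2 * cj tau.2) * ('[U2 l, U2 (x n)] - '[U2 l, orth2 u])).
rewrite !cmodM in v5.
have p1 := p _ _ t1 l1; have p2 := p _ _ t2 l2.
rewrite q {2}/D.
have z1 : cmod (1 - l.1 * cj tau.1) * cmod ('[U1 l, U1 (x n)] - '[U1 l, orth1 u]) <= 2 * (e / D).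
  by apply: ler_pM; rewrite ?cmod_ge0 // ltW.
have z2 : cmod (1 - l.2 * cj tau.2) * cmod ('[U2 l, U2 (x n)] - '[U2 l, orth2 u]) <= 2 * (e / D).
  by apply: ler_pM; rewrite ?cmod_ge0 // ltW.
have z3 : bnorm (x n - tau) * (hnorm (U1 l) * hnorm (U1 (x n)) + hnorm (U2 l) * hnorm (U2 (x n)))
   <= e / D * (C * (hnorm (U1 l) + hnorm (U2 l))).
  have bn0 : 0 <= bnorm (x n - tau).
    by apply: le_trans (cmod1_bnorm _); exact: cmod_ge0.
  apply: ler_pM => //; rewrite ?addr_ge0 ?mulr_ge0 ?hnorm_ge0 ?(ltW v4) //.
  by rewrite mulrDr lerD // [C * _]mulrC ler_wpM2l ?hnorm_ge0.
rewrite [leRHS]mulrDr; lra.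
Unshelve. all: by end_near. Qed.

End BoundaryValues.

(** * Better boundary values where there is no angular gradient *)

Section DWJulia.
Variables (R : realType) (phi : Cplx2 R -> Cplx R) (M : model phi).
Variable tau : Cplx2 R.
Implicit Types (l m : Cplx2 R) (S : set (Cplx2 R)) (a b e C s : R).
Hypothesis phiD : forall l, bidisk l -> disk (phi l).
Hypotheses (t1 : circle tau.1) (t2 : circle tau.2).

Local Notation "''[' u , v ]" := (hdot M u%R v%R) : ring_scope.
Local Notation cj z := (Num.conj (z : R[i])).
Local Notation U1 := (model_map1 M).
Local Notation U2 := (model_map2 M).

(** If the first component of a boundary value vanishes, then
    1 - phi(l) conj tau^1 = (1 - l^2 conj tau^2) <u_l^2, w>, and convergence of
    the last factor makes the right-hand side differentiable at tau, with an
    angular gradient that sees only the second variable. *)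
Lemma C_point_of_cvg (w : M) : B_point phi tau -> nontangential_lim phi tau tau.1 ->
  (forall l, bidisk l -> defect tau l 0 w = 0) ->
  (forall S, nontangential tau S -> forall e : R, 0 < e -> exists2 d : R, 0 < d &
     forall m, S m -> bnorm (m - tau) < d -> cmod ('[U2 m, w] - '[w, w]) < e) ->
  C_point phi tau.
Proof.
move=> Bp lim dw cvgw; split=> //.
exists tau.1, (0, tau.1 * cj tau.2 * '[w, w]); split=> // S NT; apply/eqoP => e e0.
have er : e = (complex.Re e)%:C by rewrite RRe_real // gtr0_real.
rewrite er in e0 *; rewrite ltcR in e0.
have [d d0 dP] := cvgw S NT _ e0.
apply/nbhs_bnorm; exists d => // l ld Sl.
have [SD _ _] := NT; have := dw l (SD l Sl).
rewrite /defect linear0r mulr0 add0r -/(U2 l) => /eqP; rewrite subr_eq0 => /eqP E.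
have -> : phi l - (tau.1 + (0 : Cplx R, tau.1 * cj tau.2 * '[w, w]).1 * (l.1 - tau.1)
    + (0 : Cplx R, tau.1 * cj tau.2 * '[w, w]).2 * (l.2 - tau.2))
  = tau.1 * cj tau.2 * (l.2 - tau.2) * ('[U2 l, w] - '[w, w]).
  have tt1 : tau.1 * cj tau.1 = 1 by rewrite cmod_sqr t1 expr1n.
  have tt2 : tau.2 * cj tau.2 = 1 by rewrite cmod_sqr t2 expr1n.
  have -> : phi l = tau.1 - tau.1 * (1 - phi l * cj tau.1).
    by rewrite mulrBr mulr1 mulrCA tt1 mulr1 opprB addrC subrK.
  have E2 : 1 - l.2 * cj tau.2 = (tau.2 - l.2) * cj tau.2 by rewrite mulrBl tt2.
  rewrite E E2 /=.
  have alg (a b c f p y z : R[i]) : a - a * ((b - c) * f * y) -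
      (a + 0 * (p - a) + a * f * z * (c - b)) = a * f * (c - b) * (y - z) by ring.
  exact: alg.
rewrite normr_cmod normr_bnorm -rmorphM lecR !cmodM cmodJ t1 t2 !mul1r mulrC.
apply: ler_pM; rewrite ?cmod_ge0 //; first exact/ltW/dP.
exact: (cmod2_bnorm (l - tau)).
Qed.

Lemma defect_affine l (w v1 v2 : M) (t : R[i]) :
  defect tau l 0 w = 0 ->
  defect tau l (t *: v1) (w + t *: (v2 - w)) = cj t * defect tau l v1 v2.
Proof.
rewrite /defect linear0r mulr0 add0r => /eqP; rewrite subr_eq0 => /eqP E.
rewrite hdotDr !hdotZr hdotBr E -/(U1 l) -/(U2 l); ring.
Qed.

(** On the affine line through [w] and [v] the squared norm has slope
    2 Re (t <v - w, w>) at [w], so a suitable phase of [t] makes it decrease as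
    soon as <v, w> differs from <w, w>. *)
Lemma hnorm_pencil (w v : M) (s e : R) : 0 < e -> 0 < s ->
  e <= cmod ('[v, w] - '[w, w]) ->
  exists2 t : R[i], cmod t = s &
    hnorm (w + t *: (v - w)) ^+ 2 <=
      hnorm w ^+ 2 - s * e *+ 2 + s ^+ 2 * (hnorm v + hnorm w) ^+ 2.
Proof.
move=> e0 s0; set z := '[v, w] - '[w, w] => ez.
have z0 : 0 < cmod z by exact: lt_le_trans ez.
exists (- ((s / cmod z)%:C * cj z)).
  by rewrite cmodN cmodM cmodJ cmodr ?divr_ge0 ?ltW // divfK // gt_eqF.
rewrite hnormD_sqr hnormZ cmodN cmodM cmodJ cmodr ?divr_ge0 ?(ltW s0) ?(ltW z0) //.
rewrite divfK ?gt_eqF // hdotZl.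
have -> : '[v - w, w] = z by rewrite hdotBl.
rewrite mulNr -mulrA [cj z * z]mulrC cmod_sqr -rmorphM -rmorphN /=.
have -> : s / cmod z * cmod z ^+ 2 = s * cmod z by field; rewrite gt_eqF.
have h : hnorm (v - w) <= hnorm v + hnorm w.
  by apply: le_trans (ler_hnormD _ _) _; rewrite hnorm_opp.
have h2 : (s * hnorm (v - w)) ^+ 2 <= s ^+ 2 * (hnorm v + hnorm w) ^+ 2.
  rewrite exprMn ler_wpM2l ?sqr_ge0 // ler_pXn2r ?nnegrE ?hnorm_ge0 ?addr_ge0 //;
  exact: hnorm_ge0.
have : s * e <= s * cmod z by rewrite ler_pM2l.
rewrite !mulr2n; lra.
Qed.

Lemma not_C_point_gap (w : M) : B_point phi tau -> nontangential_lim phi tau tau.1 ->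
  (forall l, bidisk l -> defect tau l 0 w = 0) -> ~ C_point phi tau ->
  exists S e, [/\ nontangential tau S, 0 < e &
    forall d : R, 0 < d -> exists m, [/\ S m, bnorm (m - tau) < d &
      e <= cmod ('[U2 m, w] - '[w, w])]].
Proof.
move=> Bp lim dw nC; apply: contrapT => no; apply: nC; apply: (C_point_of_cvg Bp lim dw).
move=> S NT e e0; apply: contrapT => no2; apply: no; exists S, e; split=> //.
move=> d d0; apply: contrapT => no3; apply: no2; exists d => // m Sm md.
by rewrite ltNge; apply/negP => ?; apply: no3; exists m.
Qed.

(** Points m of S at which <u_m^2, w> stays away from <w, w> give, by
    [defect_affine], near-solutions (0, w) + t (u_m - (0, w)) for
    every t; choosing t of modulus s as in [hnorm_pencil] shortens the second
    component to first order in s and lengthens the first only to second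
    order. *)
Lemma improved_boundary_value (w : M) S C s e : nontangential_lim phi tau tau.1 ->
  (forall l, bidisk l -> defect tau l 0 w = 0) -> nontangential tau S ->
  0 <= C -> (forall m, S m -> hnorm (U1 m) <= C /\ hnorm (U2 m) <= C) ->
  0 < e -> 0 < s ->
  (forall d : R, 0 < d -> exists m, [/\ S m, bnorm (m - tau) < d &
     e <= cmod ('[U2 m, w] - '[w, w])]) ->
  approx_boundary_value M tau (s ^+ 2 * C ^+ 2)
    (hnorm w ^+ 2 - s * e *+ 2 + s ^+ 2 * (C + hnorm w) ^+ 2).
Proof.
move=> lim dw NT C0 SC e0 s0 bad l e' lD e'0.
set X := hnorm (U1 l) + hnorm (U2 l).
have X0 : 0 <= X by rewrite addr_ge0 ?hnorm_ge0.
have sX : 0 < s * (1 + X * C) by rewrite mulr_gt0 // ltr_pwDl // mulr_ge0.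
have eX : 0 < e' / (s * (1 + X * C)) by rewrite divr_gt0.
have /cvg_within_cmod/(_ _ eX)[d d0 dP] := lim S NT.
have d'0 : 0 < Num.min d (e' / (s * (1 + X * C))) by rewrite lt_min d0.
have [m [Sm md em]] := bad _ d'0.
rewrite lt_min in md; case/andP: md => md md'.
have [m1 m2] := SC m Sm.
have mD : bidisk m by have [SD _ _] := NT; exact: SD.
have [t ts tn] := hnorm_pencil e0 s0 em.
exists (t *: U1 m), (w + t *: (U2 m - w)); split.
- by rewrite hnormZ ts exprMn ler_wpM2l ?sqr_ge0 // ler_pXn2r ?nnegrE ?hnorm_ge0.
- apply: le_trans tn _; rewrite lerD2l ler_wpM2l ?sqr_ge0 //.
  by rewrite ler_pXn2r ?nnegrE ?addr_ge0 ?hnorm_ge0 // lerD2r.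
rewrite defect_affine ?dw // cmodM cmodJ ts.
have df := defect_interior M phiD tau lD mD.
rewrite mulrC -ler_pdivlMr //; apply: le_trans df _.
have -> : e' / s = e' / (s * (1 + X * C)) + e' / (s * (1 + X * C)) * (X * C).
  by field; rewrite !gt_eqF // ltr_pwDl // mulr_ge0.
apply: lerD; first exact/ltW/dP.
apply: ler_pM; first by apply: le_trans (cmod1_bnorm _); exact: cmod_ge0.
- by rewrite addr_ge0 // mulr_ge0 ?hnorm_ge0.
- exact: ltW md'.
- by rewrite /X mulrDl lerD // ler_wpM2l ?hnorm_ge0.
Qed.

End DWJulia.

(** The boundary value u given by the hypothesis yields a = |u^1|^2 and
    b = |u^2|^2. If u^1 = 0 and [tau] is not a C-point, the improved boundary
    values take over, for a small s. *)
Lemma dw_julia (R : realType) (phi : Cplx2 R -> Cplx R) (M : model phi) tau (K : R) :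
  (forall l, bidisk l -> disk (phi l)) ->
  left_typeII_DW_const M tau K ->
  exists a b : R, [/\ 0 <= a < 1, 0 <= b, a + K * b <= 1,
    forall l, bidisk l -> horo tau.1 (phi l) <= a * horo tau.1 l.1 + b * horo tau.2 l.2 &
    ~ C_point phi tau -> 0 < a].
Proof.
move=> phiD [[[t1 t2] Bp lim _ _] K0 [u [Yu u1 uK]]].
have [x [xD xtau [B xB] wu]] := Yu.
have du := weak_limit_boundary_value phiD t1 t2 xD xtau xB lim wu.
set w1 := orth1 u in u1 uK du; set w2 := orth2 u in uK du.
have {}u1 : hnorm w1 < 1 by rewrite -ltcR -normr_hnorm.
have {}uK : hnorm w1 ^+ 2 + K * hnorm w2 ^+ 2 <= 1.
  by move: uK; rewrite !normr_hnorm -!rmorphXn -rmorphM -rmorphD lecR.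
have bv : approx_boundary_value M tau (hnorm w1 ^+ 2) (hnorm w2 ^+ 2).
  by move=> l e lD e0; exists w1, w2; split=> //; rewrite du // cmod0 ltW.
have z : bidisk (0 : Cplx R, 0 : Cplx R) 
  by split; change (cmod (0 : Cplx R) < 1); rewrite cmod0.
have main a b : approx_boundary_value M tau a b -> a < 1 -> a + K * b <= 1 ->
    (~ C_point phi tau -> 0 < a) -> exists a b : R, [/\ 0 <= a < 1, 0 <= b, a + K * b <= 1,
    forall l, bidisk l -> horo tau.1 (phi l) <= a * horo tau.1 l.1 + b * horo tau.2 l.2 &
    ~ C_point phi tau -> 0 < a].
  move=> ab a1 abK aC; exists a, b.
  have [v1 [v2 [va vb _]]] := ab _ 1 z ltr01.
  split=> //; last exact: julia_inequality ab.
    by rewrite a1 (le_trans _ va) ?sqr_ge0.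
  by rewrite (le_trans _ vb) ?sqr_ge0.
have h1 : hnorm w1 ^+ 2 < 1 by have := hnorm_ge0 w1; nra.
have [w10|w10] := eqVneq (hnorm w1) 0; last first.
  by apply: (main _ _ bv) => // _; rewrite exprn_gt0 // lt_neqAle eq_sym w10 hnorm_ge0.
have [Cp|Cp] := pselect (C_point phi tau); first exact: (main _ _ bv).
have w1E : w1 = 0 by apply/eqP; rewrite -normr_eq0 normr_hnorm w10.
rewrite w1E in du.
have [S [e [NT e0 bad]]] := not_C_point_gap t1 t2 Bp lim du Cp.
have [C C0 SC] := model_nontangential_bounded M phiD t1 t2 xD xtau xB NT.
have SC' m : S m -> hnorm (model_map1 M m) <= C + 1 /\ hnorm (model_map2 M m) <= C + 1.
  by move=> /SC[*]; split; lra.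
have w20 := hnorm_ge0 w2.
pose D := (C + 1 + hnorm w2) ^+ 2.
have D0 : 0 <= D by exact: sqr_ge0.
have Q0 : 0 < (C + 1) ^+ 2 + K * D by rewrite ltr_pwDl ?exprn_gt0 ?mulr_ge0 //; lra.
(* As a + K b is at most 1 - 2 K e s + ((C + 1)^2 + K D) s^2, this is the s
   for which it is smallest. *)
pose s := K * e / ((C + 1) ^+ 2 + K * D).
have s0 : 0 < s by rewrite divr_gt0 ?mulr_gt0.
have sE : s * ((C + 1) ^+ 2 + K * D) = K * e by rewrite divfK ?gt_eqF.
have bound : s ^+ 2 * (C + 1) ^+ 2 + K * (hnorm w2 ^+ 2 - s * e *+ 2 + s ^+ 2 * D) < 1.
  have : s * (s * ((C + 1) ^+ 2 + K * D)) = s * (K * e) by rewrite sE.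
  have : 0 < s * (K * e) by apply: mulr_gt0 => //; exact: mulr_gt0.
  by move: uK; rewrite w10 mulr2n; lra.
have a0 : 0 < s ^+ 2 * (C + 1) ^+ 2 by rewrite mulr_gt0 ?exprn_gt0 //; lra.
have C10 : 0 <= C + 1 by lra.
have ab := improved_boundary_value phiD lim du NT C10 SC' e0 s0 bad; rewrite -/D in ab.
apply: (main _ _ ab) => //; last exact: ltW.
have [v1 [v2 [_ vb _]]] := ab _ 1 z ltr01.
have : 0 <= hnorm w2 ^+ 2 - s * e *+ 2 + s ^+ 2 * D.
  by rewrite (le_trans _ vb) ?sqr_ge0.
move=> b0; have : 0 <= K * (hnorm w2 ^+ 2 - s * e *+ 2 + s ^+ 2 * D) by rewrite mulr_ge0 // ltW.
lra.
Qed.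

(** * Sequences dominated by coupled averages *)

Section Averages.
Variable R : realType.
Implicit Types (A B : nat -> R) (a b rho : R).

Lemma nonincreasing_cvg_ge0 A : (forall n, 0 <= A n) -> (forall n, A n.+1 <= A n) ->
  exists rho : R, [/\ 0 <= rho, forall n, rho <= A n & A n @[n --> \oo] --> rho].
Proof.
move=> A0 Adec; have cA : cvgn A.
  apply: nonincreasing_is_cvgn; last by exists 0 => _ [n _ <-].
  exact/nonincreasing_seqP.
exists (limn A); split=> //; first by apply: limr_ge => //; exact: nearW.
by apply: nonincreasing_cvgn_ge => //; exact/nonincreasing_seqP.
Qed.

Lemma cvg_even A rho : A n @[n --> \oo] --> rho -> A n.*2 @[n --> \oo] --> rho.
Proof.
move=> h; apply: cvg_comp h => P [N _ NP]; exists N => // n /= Nn.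
by apply: NP => /=; lia.
Qed.

Lemma cvg_odd A rho : A n @[n --> \oo] --> rho -> A n.*2.+1 @[n --> \oo] --> rho.
Proof.
move=> h; apply: cvg_comp h => P [N _ NP]; exists N => // n /= Nn.
by apply: NP => /=; lia.
Qed.

(** The maximum M_n of the two terms decreases to some rho. A_n enters
    the next A with weight a and the next B with weight 1 - b, both positive, so
    that a low A_n would pull M_{n+1} below rho; hence A_n tends to rho. In turn
    B_n enters the next A with the positive weight 1 - a. *)
Lemma damped_averages A B a b : (forall n, 0 <= A n) -> (forall n, 0 <= B n) ->
  0 < a < 1 -> 0 <= b < 1 ->
  (forall n, A n.+1 <= a * A n + (1 - a) * B n) ->
  (forall n, B n.+1 <= b * B n + (1 - b) * A n) ->
  exists2 rho : R, 0 <= rho & A n @[n --> \oo] --> rho /\ B n @[n --> \oo] --> rho.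
Proof.
move=> A0 B0 /andP[a0 a1] /andP[b0 b1] recA recB.
pose M n := Num.max (A n) (B n).
have AM n : A n <= M n by rewrite le_max lexx.
have BM n : B n <= M n by rewrite le_max lexx orbT.
have Mdec n : M n.+1 <= M n.
  have := AM n; have := BM n; rewrite [M n.+1]/M ge_max => ? ?; apply/andP; split.
    by apply: le_trans (recA n) _; nra.
  by apply: le_trans (recB n) _; nra.
have [n|rho [rho0 Mge Mrho]] := nonincreasing_cvg_ge0 _ Mdec; first exact: le_trans (AM n).
have MS : M n.+1 @[n --> \oo] --> rho by rewrite (cvg_shiftS M).
pose c := Num.min a (1 - b).
have [c0 ca cb] : [/\ 0 < c, c <= a & c <= 1 - b].
  by rewrite lt_min a0 subr_gt0 b1 !ge_min !lexx orbT.
have cA : A n @[n --> \oo] --> rho.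
  have low n : M n - c^-1 * (M n - M n.+1) <= A n.
    have : M n.+1 <= c * A n + (1 - c) * M n.
      have := AM n; have := BM n; rewrite [M n.+1]/M ge_max => ? ?; apply/andP; split.
        by apply: le_trans (recA n) _; nra.
      by apply: le_trans (recB n) _; nra.
    rewrite lerBlDr -lerBlDl [c^-1 * _]mulrC ler_pdivlMr //; lra.
  apply: (@squeeze_cvgr _ _ _ _ (fun n => M n - c^-1 * (M n - M n.+1)) M) => //.
    by apply: nearW => n; rewrite low AM.
  rewrite -[X in _ --> X]subr0 -(mulr0 c^-1) -(subrr rho).
  by apply: cvgB => //; apply: cvgMr; apply: cvgB.
exists rho => //; split=> //.
have AS : A n.+1 @[n --> \oo] --> rho by rewrite (cvg_shiftS A).
have low n : (1 - a)^-1 * (A n.+1 - a * M n) <= B n.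
  rewrite mulrC ler_pdivrMr ?subr_gt0 //; have := recA n; have := AM n; nra.
apply: (@squeeze_cvgr _ _ _ _ (fun n => (1 - a)^-1 * (A n.+1 - a * M n)) M) => //.
  by apply: nearW => n; rewrite low BM.
have -> : rho = (1 - a)^-1 * (rho - a * rho) by field; rewrite subr_eq0 gt_eqF.
by apply: cvgMr; apply: cvgB => //; exact: cvgMr.
Qed.

(** When a = b = 0 the recursion reads A_{n+1} <= B_n and B_{n+1} <= A_n: the
    two interlaced sequences A_0, B_1, A_2, ... and B_0, A_1, B_2, ... decrease
    independently of each other. *)
Lemma coupled_averages A B a b : (forall n, 0 <= A n) -> (forall n, 0 <= B n) ->
  0 <= a < 1 -> 0 <= b < 1 ->
  (forall n, A n.+1 <= a * A n + (1 - a) * B n) ->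
  (forall n, B n.+1 <= b * B n + (1 - b) * A n) ->
  exists rho0 rho1 : R, [/\ 0 <= rho0, 0 <= rho1,
    A n.*2 @[n --> \oo] --> rho0 /\ A n.*2.+1 @[n --> \oo] --> rho1,
    B n.*2.+1 @[n --> \oo] --> rho0 /\ B n.*2 @[n --> \oo] --> rho1 &
    0 < a \/ 0 < b -> rho0 = rho1].
Proof.
move=> A0 B0 aI bI recA recB.
have one rho : 0 <= rho -> A n @[n --> \oo] --> rho -> B n @[n --> \oo] --> rho ->
  exists rho0 rho1 : R, [/\ 0 <= rho0, 0 <= rho1,
    A n.*2 @[n --> \oo] --> rho0 /\ A n.*2.+1 @[n --> \oo] --> rho1,
    B n.*2.+1 @[n --> \oo] --> rho0 /\ B n.*2 @[n --> \oo] --> rho1 &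
    0 < a \/ 0 < b -> rho0 = rho1].
  move=> rho0 cA cB; exists rho, rho; split=> //; split.
  - exact: cvg_even. - exact: cvg_odd. - exact: cvg_odd. - exact: cvg_even.
case/andP: (aI) => a0 a1; case/andP: (bI) => b0 b1.
have dec (c : R) : 0 < c \/ c <= 0 by case: (ltP 0 c); [left|right].
have [ap|a0'] := dec a.
  by have [|rho rho0 [cA cB]] := damped_averages A0 B0 _ bI recA recB; [rewrite ap|exact: (one rho)].
have [bp|b0'] := dec b.
  by have [|rho rho0 [cB cA]] := damped_averages B0 A0 _ aI recB recA; [rewrite bp|exact: (one rho)].
have aE : a = 0 by lra.
have bE : b = 0 by lra.
have AB n : A n.+1 <= B n by have := recA n; rewrite aE; lra.
have BA n : B n.+1 <= A n by have := recB n; rewrite bE; lra.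
have [//|n|rho0 [r0 _ c0]] := @nonincreasing_cvg_ge0 (fun n => A n.*2).
  by rewrite doubleS; exact: le_trans (AB _) (BA _).
have [//|n|rho1 [r1 _ c1]] := @nonincreasing_cvg_ge0 (fun n => B n.*2).
  by rewrite doubleS; exact: le_trans (BA _) (AB _).
exists rho0, rho1; split=> //; [split=> //|split=> //|by case; lra].
- apply: (@squeeze_cvgr _ _ _ _ (fun n => B n.+1.*2) (fun n => B n.*2)) => //.
    by apply: nearW => n; rewrite doubleS BA AB.
  by rewrite (cvg_shiftS (fun n => B n.*2)).
- apply: (@squeeze_cvgr _ _ _ _ (fun n => A n.+1.*2) (fun n => A n.*2)) => //.
    by apply: nearW => n; rewrite doubleS AB BA.
  by rewrite (cvg_shiftS (fun n => A n.*2)).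
Qed.

Lemma cvg_even_odd A rho : A n.*2 @[n --> \oo] --> rho ->
  A n.*2.+1 @[n --> \oo] --> rho -> A n @[n --> \oo] --> rho.
Proof.
move=> ce co P nP; have [N1 _ P1] := ce P nP; have [N2 _ P2] := co P nP.
exists (maxn N1 N2).*2.+1 => // n /= Nn; rewrite /= -[n]odd_double_half.
have hn := odd_double_half n.
by case: (odd n) hn => hn; [apply: P2|apply: P1] => /=; lia.
Qed.

End Averages.

(** * Convergence in the horospheric topology *)

Section Horospheres.
Variable R : realType.
Implicit Types (tau l : Cplx2 R).

Lemma horo_ge0 (t z : Cplx R) : disk z -> 0 <= horo t z.
Proof. by move=> /disk_sqr zD; rewrite /horo divr_ge0 ?sqr_ge0 ?ltW. Qed.

(** [tau] lies in no subset of the bidisk, so a basic open set around it is the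
    union of {tau} and a product of horodisks at [tau]. *)
Lemma horo_cvg_of_cvg0 (x : nat -> Cplx2 R) tau : circle tau.1 -> circle tau.2 ->
  (forall n, bidisk (x n)) ->
  horo tau.1 (x n).1 @[n --> \oo] --> (0 : R) ->
  horo tau.2 (x n).2 @[n --> \oo] --> (0 : R) -> horo_cvg x tau.
Proof.
move=> t1 t2 xD c1 c2 U [G GB <-] [V GV Vt].
have tD : ~ bidisk tau by move=> [] /[swap] _; rewrite /disk /= t1 ltxx.
case: (GB V GV) => [[_ VD]|[s [r1 [r2 [sb r10 r20 VE]]]]]; first by case: tD; exact: VD.
have st : s = tau.
  move: Vt; rewrite VE => -[->//|[[d1 _] [d2 _]]].
  by case: tD.
have n1 : \forall n \near \oo, horo tau.1 (x n).1 < r1.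
  by apply: (cvgr_lt _ c1).
have n2 : \forall n \near \oo, horo tau.2 (x n).2 < r2.
  by apply: (cvgr_lt _ c2).
apply: filterS2 n1 n2 => n h1 h2; exists V => //; rewrite VE st; right.
by have [d1 d2] := xD n; split; split.
Qed.

End Horospheres.

(** * Exchange of the coordinates *)

Section Swap.
Variable R : realType.
Implicit Types (tau l : Cplx2 R).

Definition swap l : Cplx2 R := (l.2, l.1).

Lemma swapK : involutive swap.
Proof. by case. Qed.

Lemma bnorm_swap l : bnorm (swap l) = bnorm l.
Proof. by rewrite /bnorm /= maxC. Qed.

Lemma swap_near tau (P : set (Cplx2 R)) :
  nbhs tau P -> nbhs (swap tau) [set l | P (swap l)].
Proof.
move=> /nbhs_bnorm[d d0 dP]; apply/nbhs_bnorm; exists d => // l ld; apply: dP.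
by rewrite -bnorm_swap.
Qed.

Lemma nontangential_swap tau S :
  nontangential tau S -> nontangential (swap tau) [set l | S (swap l)].
Proof.
move=> [SD Scl [c c0 Sc]]; split.
- by move=> l /SD[].
- move=> P /swap_near/Scl[l [Sl Pl]].
  by exists (swap l); split=> //=; rewrite /swap -surjective_pairing.
- by exists c => // l /Sc; rewrite -[bnorm (swap l)]bnorm_swap -[bnorm (tau - _)]bnorm_swap.
Qed.

(** Exchanging the coordinates preserves the max-norm, hence Julia quotients and
    nontangential sets; the entries of the angular gradient are exchanged. *)
Lemma C_point_tilde (psi : Cplx2 R -> Cplx R) tau :
  C_point (tilde psi) (swap tau) -> C_point psi tau.
Proof.
have sE l : psi l = tilde psi (swap l) by rewrite /tilde /= -surjective_pairing.
move=> [[bd Bp] [w [eta [lim lin]]]]; split.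
  split; first by rewrite /bidisk_boundary /= -bnorm_swap.
  apply: le_lt_trans Bp; rewrite !limf_einfE.
  apply: ub_ereal_sup => _ [V FV <-].
  apply: ereal_sup_ge.
  exists (ereal_inf [set (julia_quotient (tilde psi) l)%:E | l in [set l | V (swap l)]]).
    exists [set l | V (swap l)] => //.
    apply: filterS (swap_near FV) => l Vl lD; apply: Vl; by case: lD.
  apply: le_ereal_inf => _ [l Vl <-]; exists (swap l) => //.
  by rewrite /julia_quotient bnorm_swap.
exists w, (eta.2, eta.1); split.
  move=> S NT; have /cvg_within_cmod h := lim _ (nontangential_swap NT).
  apply/cvg_within_cmod => e /h[d d0 dP]; exists d => // l Sl ld.
  rewrite sE; apply: dP; first by rewrite /= /swap /= -surjective_pairing.
  by rewrite -[X in X < _]bnorm_swap.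
move=> S NT; have := lin _ (nontangential_swap NT) => /= h; apply/eqoP => e e0.
have /= := (iffLR (eqoP _ _ _) h) e e0 => /swap_near; apply: filterS => l Hl Sl.
have Ssl : [set m | S (swap m)] (swap l) by rewrite /mkset swapK.
have -> : `|l - tau| = `|swap l - swap tau| by rewrite !normr_bnorm -bnorm_swap.
rewrite sE [w + eta.2 * _ + _]addrAC; exact: Hl.
Qed.

End Swap.

(** * Limits of the horospheric quotients along an orbit *)

Local Close Scope complex_scope.

Theorem theorem5p2 (R : realType) (phi psi : Cplx2 R -> Cplx R)
    (M : model phi) (N : model (tilde psi)) (tau : Cplx2 R) (K : R)
    (la0 mu0 : Cplx R) :
  let F : Cplx2 R -> Cplx2 R := fun l => (phi l, psi l) in
  let A : nat -> R := fun n => horo tau.1 (iter n F (la0, mu0)).1 in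
  let B : nat -> R := fun n => horo tau.2 (iter n F (la0, mu0)).2 in
  holomorphic_bidisk_disk phi ->
  holomorphic_bidisk_disk psi ->
  (forall l, bidisk l -> F l <> l) ->
  left_typeII phi ->
  right_typeII psi ->
  circle tau.1 -> circle tau.2 ->
  0 < K ->
  left_typeII_DW_const M tau K ->
  right_typeII_DW_const N tau K^-1 ->
  bidisk (la0, mu0) ->
  horo_cvg (fun n => iter n F (la0, mu0)) tau \/
  exists rho0 rho1 : R,
    [/\ 0 <= rho0, 0 <= rho1, ~ (rho0 = 0 /\ rho1 = 0),
        [/\ A n.*2 @[n --> \oo] --> rho0,
            A n.*2.+1 @[n --> \oo] --> rho1,
            B n.*2.+1 @[n --> \oo] --> K * rho0 &
            B n.*2 @[n --> \oo] --> K * rho1] &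
        (~ C_point phi tau \/ ~ C_point psi tau) -> rho0 = rho1].
Proof.
move=> F A B [_ phiD] [_ psiD] _ _ _ t1 t2 K0 dwphi dwpsi lD.
have K0' : K != 0 by rewrite gt_eqF.
have [a [b [aI b0 abK jphi Cphi]]] := dw_julia phiD dwphi.
have psiD' l : bidisk l -> disk (tilde psi l) by move=> [d1 d2]; exact: psiD.
have [a' [b' [a'I b'0 abK' jpsi Cpsi]]] := dw_julia psiD' dwpsi.
have xD n : bidisk (iter n F (la0, mu0)).
  by elim: n => [//|n IH] /=; split; [exact: phiD|exact: psiD].
have A0 n : 0 <= A n by apply: horo_ge0; case: (xD n).
have B0 n : 0 <= B n by apply: horo_ge0; case: (xD n).
have BK n : B n = K * (B n / K) by field.
have BK0 n : 0 <= B n / K by rewrite divr_ge0 // ltW.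
have recA n : A n.+1 <= a * A n + (1 - a) * (B n / K).
  apply: le_trans (jphi _ (xD n)) _; rewrite -/(A n) -/(B n) lerD2l {1}BK mulrA.
  by rewrite ler_wpM2r //; lra.
have recB n : B n.+1 / K <= a' * (B n / K) + (1 - a') * A n.
  rewrite ler_pdivrMr //.
  have sD : bidisk (swap (iter n F (la0, mu0))) by have [] := xD n.
  have := jpsi _ sD; rewrite /tilde /= -surjective_pairing -/(A n) -/(B n) => /le_trans; apply.
  have -> : (a' * (B n / K) + (1 - a') * A n) * K = a' * B n + (1 - a') * K * A n by field.
  rewrite lerD2l ler_wpM2r // -ler_pdivrMr //; lra.
have [r0 [r1 [r00 r10 [cA0 cA1] [cB0 cB1] r01]]] :=
  coupled_averages A0 BK0 aI a'I recA recB.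
have KB0 : B n.*2.+1 @[n --> \oo] --> K * r0.
  by under eq_fun do rewrite BK; exact: cvgMr.
have KB1 : B n.*2 @[n --> \oo] --> K * r1.
  by under eq_fun do rewrite BK; exact: cvgMr.
have [[z0 z1]|nz] := pselect (r0 = 0 /\ r1 = 0); [left|right].
  rewrite z0 z1 !mulr0 in cA0 cA1 KB0 KB1.
  by apply: horo_cvg_of_cvg0 => //; exact: cvg_even_odd.
exists r0, r1; split=> // -[nC|nC]; apply: r01; [left; exact: Cphi|right].
by apply: Cpsi => /C_point_tilde.
Qed.
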